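(* A poset $P$ has one-step closure if and only if $P$ is meet continuous and has weak one-step closure.
   Context: Let $P$ be a poset. For $A\subseteq P$, $\mathord{\uparrow}A=\{y\in P: x\le y\text{ for some }x\in A\}$, $\mathord{\downarrow}A=\{y\in P: y\le x\text{ for some }x\in A\}$, and $\mathord{\downarrow}x=\mathord{\downarrow}\{x\}$. A directed subset is a nonempty subset $D$ in which every finite subset has an upper bound in $D$. A subset $U$ is Scott open if $U=\mathord{\uparrow}U$ and for every directed $D$ such that $\sup D$ exists and lies in $U$, $D\cap U\neq\emptyset$; $cl$ denotes closure in the resulting Scott topology. For $A\subseteq P$ put $A'=\{x\in P\mid \text{there is a directed } D\subseteq\mathord{\downarrow}A\text{ with } x=\sup D\}$ and $A''=\{x\in P\mid \text{there is a directed } D\subseteq\mathord{\downarrow}A\text{ such that }\sup D\text{ exists and } x\le\sup D\}$. $P$ has one-step closure if $cl(A)=A'$ for every $A\subseteq P$; $P$ has weak one-step closure if $cl(A)=A''$ for every $A\subseteq P$. $P$ is meet continuous if for every $x\in P$ and every directed $D\subseteq P$ for which $\sup D$ exists, $x\le\sup D$ implies $x\in cl(\mathord{\downarrow}D\cap\mathord{\downarrow}x)$. *)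

(* Defs.v *)
From HB Require Import structures.
From mathcomp Require Import all_boot all_order.
From mathcomp Require Import boolp classical_sets functions cardinality.
From mathcomp Require Import topology_structure.

Set Implicit Arguments.
Unset Strict Implicit.
Unset Printing Implicit Defensive.

Import Order.TTheory.

Local Open Scope classical_set_scope.
Local Open Scope order_scope.

(* The lower set generated by [A] is the library's [down A]. *)
Definition up (d : Order.disp_t) (P : porderType d) (A : set P) : set P :=
  [set y | exists x, A x /\ x <= y].

Definition directed (d : Order.disp_t) (P : porderType d) (D : set P) : Prop :=
  D !=set0 /\
  forall F : set P, F `<=` D -> finite_set F -> exists u, D u /\ ubound F u.

(* "[sup D] exists and equals [s]" is the library's [isLub D s]. *)
Definition scott_open (d : Order.disp_t) (P : porderType d) (U : set P)
    : Prop :=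
  U = up U /\
  forall (D : set P) (s : P), directed D -> isLub D s -> U s ->
    D `&` U !=set0.

Lemma scott_openT (d : Order.disp_t) (P : porderType d) :
  scott_open [set: P].
Proof.
split; first by apply/seteqP; split=> // x _; exists x.
by move=> D s [[x Dx] _] _ _; exists x.
Qed.

Lemma scott_openI (d : Order.disp_t) (P : porderType d) (U V : set P) :
  scott_open U -> scott_open V -> scott_open (U `&` V).
Proof.
move=> [Uup Usup] [Vup Vsup]; split.
  apply/seteqP; split=> [x UVx|y [x [[Ux Vx] xy]]]; first by exists x.
  by split; [rewrite Uup|rewrite Vup]; exists x.
move=> D s dD Ds [Us Vs].
have [x [Dx Ux]] := Usup D s dD Ds Us.
have [y [Dy Vy]] := Vsup D s dD Ds Vs.
have [||z [Dz zub]] := dD.2 [set x; y]; first by move=> _ [->|->].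
  exact: finite_set2.
exists z; split=> //; split.
- by rewrite Uup; exists x; split=> //; apply: zub; left.
- by rewrite Vup; exists y; split=> //; apply: zub; right.
Qed.

Lemma scott_open_bigU (d : Order.disp_t) (P : porderType d) (I : Type)
    (f : I -> set P) :
  (forall i, scott_open (f i)) -> scott_open (\bigcup_i f i).
Proof.
move=> fop; split.
  apply/seteqP; split=> [x fx|y [x [[i _ fix_] xy]]]; first by exists x.
  by exists i => //; rewrite (fop i).1; exists x.
move=> D s dD Ds [i _ fis].
by have [x [Dx fix_]] := (fop i).2 D s dD Ds fis; exists x; split=> //; exists i.
Qed.

(* A copy of [P] carrying the Scott topology, so that a topology already
   present on [P] cannot be picked up instead. *)
Definition scott (d : Order.disp_t) (P : porderType d) : Type := P.

HB.instance Definition _ (d : Order.disp_t) (P : porderType d) :=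
  Order.POrder.on (scott P).

HB.instance Definition _ (d : Order.disp_t) (P : porderType d) :=
  isOpenTopological.Build (scott P) (@scott_openT d P) (@scott_openI d P)
    (@scott_open_bigU d P).

Lemma scott_openE (d : Order.disp_t) (P : porderType d) :
  (open : set (set (scott P))) = @scott_open d P.
Proof.
apply/seteqP; split=> U /=.
- rewrite openE => Uo.
  have -> : U = \bigcup_(V : {V : set P | scott_open V /\ V `<=` U}) sval V.
    apply/seteqP; split=> [x /Uo [V [Vo Vx VU]]|x [[V [Vo VU]] _ /VU //]].
    by exists (exist _ V (conj Vo VU)).
  by apply: scott_open_bigU => -[V []].
- by move=> Uo; rewrite openE => x Ux; exists U; split.
Qed.

Definition scott_closure (d : Order.disp_t) (P : porderType d) (A : set P)
    : set P :=
  closure (A : set (scott P)).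

Definition one_step (d : Order.disp_t) (P : porderType d) (A : set P) : set P :=
  [set x | exists D : set P, [/\ directed D, D `<=` down A & isLub D x]].

Definition weak_one_step (d : Order.disp_t) (P : porderType d) (A : set P)
    : set P :=
  [set x | exists D : set P, [/\ directed D, D `<=` down A
                               & exists s, isLub D s /\ x <= s]].

Definition one_step_closure (d : Order.disp_t) (P : porderType d) : Prop :=
  forall A : set P, scott_closure A = one_step A.

Definition weak_one_step_closure (d : Order.disp_t) (P : porderType d) : Prop :=
  forall A : set P, scott_closure A = weak_one_step A.

Definition meet_continuous (d : Order.disp_t) (P : porderType d) : Prop :=
  forall (x : P) (D : set P) (s : P), directed D -> isLub D s -> x <= s ->
    scott_closure (down D `&` down [set x]) x.

(* Main.v *)
Require Import Defs.
From HB Require Import structures.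
From mathcomp Require Import all_boot all_order.
From mathcomp Require Import classical_sets topology_structure.

(** Write [A'] and [A''] for the one-step and weak one-step closures of [A] and
    [cl A] for its Scott closure.  Always [A' `<=` A'' `<=` cl A]: an open set
    containing [x <= sup D], with [D `<=` down A], contains [sup D], hence meets
    [D], hence meets [A] ([sub_weak_one_step_closure]).  So one-step closure
    squeezes [A''] between [A'] and [cl A].

    The two closures differ in whether a point [x <= sup D] is itself a directed
    supremum of elements of [down D].  Such a supremum is the same thing as a
    directed set lying below both [D] and [x] whose supremum is above [x],
    because staying below [x] forces that supremum to be [x]
    ([isLub_below_eq]).  Meet continuity, [x] in
    [cl (down D `&` down [set x])], produces such a set as soon as the outer
    closure is computed by weak one-step closure; conversely such a set
    witnesses meet continuity, and one-step closure supplies it. *)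

Set Implicit Arguments.
Unset Strict Implicit.
Unset Printing Implicit Defensive.

Import Order.TTheory.

Local Open Scope classical_set_scope.
Local Open Scope order_scope.

(** Turns the inequality of the weak one-step closure into the equality that
    the one-step closure asks for. *)
Lemma isLub_below_eq (d : Order.disp_t) (P : porderType d) (D : set P)
    (s x : P) : isLub D s -> D `<=` down [set x] -> x <= s -> s = x.
Proof.
move=> [_ s_least] Dx xs; apply/le_anti; rewrite xs andbT.
by apply: s_least => y /Dx/downP[_ -> yx].
Qed.

Lemma sub_one_step_weak (d : Order.disp_t) (P : porderType d) (A : set P) :
  one_step A `<=` weak_one_step A.
Proof. by move=> x [D [dD DA Dx]]; exists D; split=> //; exists x. Qed.

(** Scott closed sets are lower sets stable under directed suprema, so they
    absorb both the passage to [sup D] and the descent from it to [x]. *)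
Lemma sub_weak_one_step_closure (d : Order.disp_t) (P : porderType d)
    (A : set P) : weak_one_step A `<=` scott_closure A.
Proof.
move=> x [D [dD DA [s [Ds xs]]]] B.
rewrite nbhsE => -[U [Uopen Ux] UB].
move: Uopen; rewrite scott_openE => -[Uup Usup].
have Us : U s by rewrite Uup; exists x.
have [y [Dy Uy]] := Usup D s dD Ds Us.
have /downP[a Aa ya] := DA y Dy.
by exists a; split=> //; apply: UB; rewrite Uup; exists y.
Qed.

Lemma one_step_closure_weak (d : Order.disp_t) (P : porderType d) :
  one_step_closure P -> weak_one_step_closure P.
Proof.
move=> osc A; apply/seteqP; split; last exact: sub_weak_one_step_closure.
by rewrite osc; exact: sub_one_step_weak.
Qed.

(** Since [x] lies in [cl D], it is the supremum of some directed [E] in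
    [down D]; as [x] bounds [E], the same [E] shows that [x] is in the closure
    of [down D `&` down [set x]]. *)
Lemma one_step_closure_meet_continuous (d : Order.disp_t) (P : porderType d) :
  one_step_closure P -> meet_continuous P.
Proof.
move=> osc x D s dD Ds xs.
have : scott_closure D x.
  apply: sub_weak_one_step_closure; exists D; split=> //; last by exists s.
  by move=> y Dy; apply/downP; exists y.
rewrite osc => -[E [dE ED Ex]].
apply: sub_weak_one_step_closure; exists E; split=> //; last by exists x.
move=> y Ey; apply/downP; exists y => //; split; first exact: ED.
by apply/downP; exists x => //; apply: Ex.1.
Qed.

(** Weak one-step closure is used twice: on [A], to find [D] with [x <= sup D],
    and on the part of [down D] below [x], to find a directed set there whose
    supremum can only be [x]. *)
Lemma meet_continuous_weak_one_step (d : Order.disp_t) (P : porderType d) :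
  meet_continuous P -> weak_one_step_closure P -> one_step_closure P.
Proof.
move=> mc wosc A; rewrite wosc.
apply/seteqP; split; last exact: sub_one_step_weak.
move=> x [D [dD DA [s [Ds xs]]]].
have := mc x D s dD Ds xs; rewrite wosc => -[E [dE EDx [t [Et xt]]]].
have tx : t = x.
  apply: isLub_below_eq Et _ xt => y /EDx/downP[z [_ /downP[_ -> zx]] yz].
  by apply/downP; exists x => //; exact: le_trans yz zx.
exists E; split=> //; last by rewrite -tx.
move=> y /EDx/downP[z [/downP[w /DA/downP[a Aa wa] zw] _] yz].
by apply/downP; exists a => //; exact: le_trans yz (le_trans zw wa).
Qed.

Theorem theorem5p10 (d : Order.disp_t) (P : porderType d) :
  one_step_closure P <-> meet_continuous P /\ weak_one_step_closure P.
Proof.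
split=> [osc | [mc wosc]]; last exact: meet_continuous_weak_one_step.
by split; [exact: one_step_closure_meet_continuous | exact: one_step_closure_weak].
Qed.
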